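(* Let $H$ be a hypergraph containing some $2$-edges and let $H'$ be its $2$-subdivision. If $H$ is degenerate, then so is $H'$.
   Context: A hypergraph $H=(V,E)$ has finite vertex set $V$ and edge set $E\subseteq 2^V$; $R(H)=\{|F|:F\in E\}$. $H_1\subseteq H_2$ means there is an injective $f\colon V(H_1)\to V(H_2)$ with $f(F)\in E(H_2)$ for all $F\in E(H_1)$. For $G$ on $n$ vertices, $h_n(G)=\sum_{F\in E(G)}1/\binom{n}{|F|}$; $\pi_n(H)=\max\{h_n(G): G\text{ on } n \text{ vertices}, R(G)\subseteq R(H), H\not\subseteq G\}$ and $\pi(H)=\lim_n\pi_n(H)$. $H$ is degenerate if $\pi(H)=|R(H)|-1$. The $2$-subdivision of $H$: if $H$ has $2$-edges $\{u_1,v_1\},\dots,\{u_t,v_t\}$, add $t$ new vertices $x_1,\dots,x_t$ and replace each $\{u_i,v_i\}$ by the two edges $\{u_i,x_i\},\{x_i,v_i\}$, keeping all other edges. *)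

(* Defs.v *)
From HB Require Import structures.
From mathcomp Require Import all_boot all_order all_algebra.
From mathcomp Require Import all_classical all_reals topology normedtype sequences.
From mathcomp Require Import Rstruct Rstruct_topology.
Set Implicit Arguments. Unset Strict Implicit. Unset Printing Implicit Defensive.
Import Order.TTheory GRing.Theory Num.Theory.
Local Open Scope ring_scope.

(* A hypergraph is a finite vertex type V together with an edge set
   E : {set {set V}}. *)

Definition edge_sizes (V : finType) (E : {set {set V}}) : seq nat :=
  undup [seq #|(F : {set V})| | F in E].

Definition hcontains (V1 : finType) (E1 : {set {set V1}})
    (V2 : finType) (E2 : {set {set V2}}) : bool :=
  [exists f : {ffun V1 -> V2},
     injectiveb f && [forall F in E1, (f @: F) \in E2]].

Definition hdens (n : nat) (G : {set {set 'I_n}}) : Rdefinitions.R :=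
  \sum_(F in G) ('C(n, #|F|)%:R)^-1.

Definition admissible (V : finType) (E : {set {set V}}) (n : nat)
    (G : {set {set 'I_n}}) : bool :=
  all (fun k => k \in edge_sizes E) (edge_sizes G) && ~~ hcontains E G.

(* π_n(H) = max of h_n(G) over admissible G (all h_n are >= 0, so starting
   the max at 0 is harmless; the admissible family is nonempty whenever H
   has an edge, witnessed by the empty hypergraph). *)
Definition pi_n (V : finType) (E : {set {set V}}) (n : nat) : Rdefinitions.R :=
  \big[Num.max/0]_(G : {set {set 'I_n}} | admissible E G) hdens G.

Definition degenerate (V : finType) (E : {set {set V}}) : Prop :=
  ((fun n => pi_n E n) @ \oo --> ((size (edge_sizes E))%:R - 1 : Rdefinitions.R))%classic.

Definition two_edges (V : finType) (E : {set {set V}}) :=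
  {F : {set V} | (F \in E) && (#|F| == 2)}.

Definition subdiv_vertex (V : finType) (E : {set {set V}}) : finType :=
  (V + two_edges E)%type.

Definition subdiv (V : finType) (E : {set {set V}}) : {set {set subdiv_vertex E}} :=
  [set (@inl V (two_edges E)) @: F | F : {set V} in E & #|F| != 2]
  :|: \bigcup_(e : two_edges E) [set [set inl x; inr e] | x in val e].

(* Main.v *)
(** Let [G] be a hypergraph on [n] vertices without the subdivision of [H], and
    [M] the number of vertices of that subdivision.  Replace the 2-edges of
    [G] by the pairs having at least [M] common neighbours.  A copy of [H] in
    the resulting [G'] would yield a subdivided copy in [G], choosing the
    subdividing vertices greedily, so [G'] is [H]-free.  Moreover [G'] has at
    most [o(n^2)] fewer 2-edges than [G]: the degree of [v] in [G'] is, up to a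
    small error, at least the average of [d(w)] over the neighbours [w] of [v],
    and these averages add up to at least the sum of the degrees because
    [d(w)/d(v) + d(v)/d(w) >= 2].  Hence the Turan density of the subdivision
    is at most that of [H]; conversely, all edges with sizes in [R(H)] other
    than a fixed one give the lower bound [|R(H)| - 1]. *)
Require Import Defs.
(* The classical libraries come first, as they shadow lemmas of finset. *)
From mathcomp Require Import all_classical all_reals topology normedtype.
From mathcomp Require Import sequences realfun Rstruct_topology.
From mathcomp Require Import all_boot all_order all_algebra.
From mathcomp Require Import ring.
Set Implicit Arguments. Unset Strict Implicit. Unset Printing Implicit Defensive.
Import Order.TTheory GRing.Theory Num.Theory.
Import numFieldNormedType.Exports.

Definition neighbors (T : finType) (a : rel T) (v : T) : {set T} :=
  [set w | a v w].

Definition degree (T : finType) (a : rel T) (v : T) : nat := #|neighbors a v|.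

Definition codegree (T : finType) (a : rel T) (v w : T) : nat :=
  #|neighbors a v :&: neighbors a w|.

Definition codegree_rel (T : finType) (a : rel T) (M : nat) : rel T :=
  fun v w => (v != w) && (M <= codegree a v w).

Section NeighborSums.
Variables (T : finType) (a : rel T).
Hypothesis a_sym : symmetric a.

Lemma sum_degree_neighbors v :
  \sum_(w in neighbors a v) degree a w = \sum_u codegree a v u.
Proof.
transitivity (\sum_(w in neighbors a v) \sum_u (u \in neighbors a w : nat)).
  by apply: eq_bigr => w _; rewrite /degree -sum1_card big_mkcond.
rewrite exchange_big; apply: eq_bigr => u _; rewrite /codegree -sum1_card.
rewrite big_mkcond [RHS]big_mkcond; apply: eq_bigr => w _.
by rewrite !inE [a u w]a_sym; case: (a v w); case: (a w u).
Qed.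

Lemma sum_degree_neighbors_le M v :
  \sum_(w in neighbors a v) degree a w <=
  degree a v * (degree (codegree_rel a M) v).+1 + M * #|T|.
Proof.
rewrite sum_degree_neighbors; set B := v |: neighbors (codegree_rel a M) v.
have codegree_le u : codegree a v u <= (u \in B) * degree a v + M.
  rewrite !inE /codegree_rel; case: (eqVneq u v) => [->|_].
    by rewrite /codegree setIid mul1n leq_addr.
  case: (leqP M) => [_|/ltnW le_M] /=; last by rewrite add0n.
  by rewrite mul1n (leq_trans _ (leq_addr _ _)) // subset_leq_card // subsetIl.
have cardB : #|B| <= (degree (codegree_rel a M) v).+1.
  by rewrite cardsU1; case: (v \notin _).
apply: leq_trans (leq_sum _ (fun u _ => codegree_le u)) _.
rewrite big_split /= sum_nat_const (mulnC M) leq_add2r -big_distrl /=.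
by rewrite mulnC -big_mkcond sum1_card leq_mul2l cardB orbT.
Qed.

End NeighborSums.

Local Open Scope ring_scope.

Lemma div_addr_div_ge2 (R : realFieldType) (s t : R) :
  0 < s -> 0 < t -> 2 <= s / t + t / s.
Proof.
move=> s_gt0 t_gt0; rewrite -subr_ge0.
have -> : s / t + t / s - 2 = (s - t) ^+ 2 / (s * t).
  by field; rewrite !gt_eqF.
by rewrite divr_ge0 ?sqr_ge0 // mulr_ge0 // ltW.
Qed.

Definition codegree_loss (R : realFieldType) (M n : nat) (D : R) : R :=
  1 + D + M%:R * n%:R / D.

Lemma codegree_loss_ge0 (R : realFieldType) M n (D : R) :
  0 < D -> 0 <= codegree_loss M n D.
Proof. by move=> D_gt0; rewrite !addr_ge0 ?divr_ge0 ?mulr_ge0 // ltW. Qed.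

Section DegreeSums.
Variables (R : realFieldType) (T : finType) (a : rel T).
Hypothesis a_sym : symmetric a.

Lemma sum_degree_le_ratio (x : T -> R) :
  (forall v, 0 < x v) ->
  \sum_v (degree a v)%:R <= \sum_v \sum_(w in neighbors a v) x w / x v.
Proof.
move=> x_gt0.
have ratio_sym : \sum_v \sum_(w in neighbors a v) x w / x v =
                 \sum_v \sum_(w in neighbors a v) x v / x w.
  rewrite (exchange_big_dep predT) //=; apply: eq_bigr => v _.
  by apply: eq_bigl => w; rewrite !inE a_sym.
suff: \sum_v (degree a v)%:R *+ 2 <=
      \sum_v \sum_(w in neighbors a v) (x w / x v + x v / x w).
  under [X in _ <= X -> _]eq_bigr do rewrite big_split.
  by rewrite sumrMnl big_split /= -ratio_sym -mulr2n lerMn2r.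
apply: ler_sum => v _; rewrite /degree -sum1_card natr_sum -sumrMnl.
by apply: ler_sum => w _; apply: div_addr_div_ge2.
Qed.

Variables (M : nat) (D : R).
Hypothesis D_gt0 : 0 < D.

(* Shifting the degrees by [D] keeps the error term
   [M * #|T| / (degree a v + D)] small at vertices of low degree. *)
Lemma sum_shifted_degree_ratio_le (v : T) :
  \sum_(w in neighbors a v) ((degree a w)%:R + D) / ((degree a v)%:R + D) <=
  (degree (codegree_rel a M) v)%:R + codegree_loss M #|T| D.
Proof.
set d := (degree a v)%:R; set b := (degree _ v)%:R.
have D_ge0 := ltW D_gt0.
have sum_le : \sum_(w in neighbors a v) ((degree a w)%:R + D) <=
              d * (b + 1) + M%:R * #|T|%:R + D * d.
  rewrite big_split /= sumr_const -[D *+ _]mulr_natr lerD2r -natr_sum natr1.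
  by rewrite -!natrM -natrD ler_nat sum_degree_neighbors_le.
rewrite -mulr_suml ler_pdivrMr ?ltr_wpDl // (le_trans sum_le) //.
rewrite /codegree_loss; set q := _ / D.
have -> : M%:R * #|T|%:R = q * D by rewrite divfK // gt_eqF.
have q_ge0 : 0 <= q by rewrite divr_ge0 ?mulr_ge0.
rewrite -subr_ge0; set diff := (X in 0 <= X).
have -> : diff = D + b * D + D * D + q * d by rewrite /diff; ring.
by rewrite !addr_ge0 // mulr_ge0.
Qed.

Lemma sum_degree_le_codegree_rel :
  \sum_v (degree a v)%:R <=
  \sum_v (degree (codegree_rel a M) v)%:R + #|T|%:R * codegree_loss M #|T| D.
Proof.
have shifted_gt0 v : 0 < (degree a v)%:R + D by rewrite ltr_wpDl.
apply: le_trans (sum_degree_le_ratio shifted_gt0) _.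
rewrite mulr_natl -sumr_const -big_split /=; apply: ler_sum => v _.
exact: sum_shifted_degree_ratio_le.
Qed.

End DegreeSums.

Lemma injective_choice (T U : finType) (C : T -> {set U}) :
  (forall x, #|T| <= #|C x|)%N ->
  exists2 g : T -> U, injective g & forall x, g x \in C x.
Proof.
move=> C_large.
have [x|g0 _] := fin_all_exists (P := fun x y => y \in C x).
  apply/set0Pn; rewrite -card_gt0; apply: leq_trans (C_large x).
  by apply/card_gt0P; exists x.
have choose_on s : uniq s ->
    forall C' : T -> {set U}, {in s, forall x, size s <= #|C' x|}%N ->
    exists2 g : T -> U, {in s &, injective g} & {in s, forall x, g x \in C' x}.
  elim: s => [|x s IHs] /=; first by exists g0.
  case/andP=> x_notin s_uniq C' C'_large.
  have /card_gt0P[y yC] : (0 < #|C' x|)%N.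
    by apply: leq_trans (C'_large x _); rewrite ?mem_head.
  have [z zs|g g_inj gC] := IHs s_uniq (fun z => C' z :\ y).
    have := C'_large z (mem_behead (s := x :: s) zs).
    by rewrite (cardsD1 y); case: (y \in _) => //; apply: ltnW.
  have neq_x z : z \in s -> (z == x) = false.
    by move=> zs; apply: contraNF x_notin => /eqP <-.
  have neq_y z : z \in s -> g z != y by move/gC; rewrite !inE => /andP[].
  exists (fun z => if z == x then y else g z) => [z1 z2|z]; rewrite !inE.
    case/predU1P=> [->|z1s] /predU1P[->|z2s] //; rewrite ?eqxx ?neq_x //.
    - by move/esym/eqP; rewrite (negbTE (neq_y _ z2s)).
    - by move/eqP; rewrite (negbTE (neq_y _ z1s)).
    - exact: g_inj.
  case/predU1P=> [->|zs]; first by rewrite eqxx.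
  by rewrite neq_x //; have := gC z zs; rewrite inE => /andP[].
have [x _|g g_inj gC] := choose_on _ (enum_uniq T) C.
  by rewrite -cardE.
by exists g => [x y|x]; [apply: g_inj|apply: gC]; rewrite mem_enum.
Qed.

Lemma edge_sizesP (V : finType) (E : {set {set V}}) k :
  reflect (exists2 F, F \in E & k = #|F|) (k \in edge_sizes E).
Proof.
by rewrite mem_undup; apply: (iffP imageP) => -[F FE ->]; exists F.
Qed.

Lemma hcontainsP (V1 V2 : finType) (E1 : {set {set V1}}) (E2 : {set {set V2}}) :
  reflect (exists2 f : V1 -> V2, injective f &
             forall F, F \in E1 -> f @: F \in E2)
          (hcontains E1 E2).
Proof.
apply: (iffP existsP) => [[f /andP[/injectiveP f_inj /forall_inP fE]]|].
  by exists f.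
case=> f f_inj fE; exists (finfun f); apply/andP; split.
  by apply/injectiveP => u v; rewrite !ffunE; apply: f_inj.
apply/forall_inP => F /fE.
by rewrite (eq_imset (g := finfun f)) // => u; rewrite ffunE.
Qed.

Lemma admissibleP (V : finType) (E : {set {set V}}) n (G : {set {set 'I_n}}) :
  reflect ((forall F, F \in G -> #|F| \in edge_sizes E) /\ ~~ hcontains E G)
          (admissible E G).
Proof.
apply: (iffP andP) => -[sizes free]; split=> //.
  by move=> F FG; apply: (allP sizes); apply/edge_sizesP; exists F.
by apply/allP => k /edge_sizesP[F FG ->]; apply: sizes.
Qed.

Section Subdivision.
Variables (V : finType) (E : {set {set V}}).

Lemma subdivP (F : {set subdiv_vertex E}) :
  reflect ((exists F0 : {set V},
              [/\ F0 \in E, #|F0| != 2 & F = (@inl V (two_edges E)) @: F0]) \/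
           (exists (e : two_edges E) (x : V),
              x \in val e /\ F = [set inl x; inr e]))
          (F \in subdiv E).
Proof.
rewrite inE; apply: (iffP orP) => -[].
- by case/imsetP => F0; rewrite inE => /andP[? ?] ->; left; exists F0.
- by case/bigcupP => e _ /imsetP[x xe ->]; right; exists e, x.
- case=> F0 [F0E F0_not2 ->]; left; apply/imsetP; exists F0 => //.
  by rewrite inE F0E.
- case=> e [x [xe ->]]; right; apply/bigcupP; exists e => //.
  by apply/imsetP; exists x.
Qed.

Lemma card_two_edges (e : two_edges E) : #|val e| = 2%N.
Proof. by have /andP[_ /eqP] := valP e. Qed.

Lemma two_edges_in (e : two_edges E) : val e \in E.
Proof. by have /andP[] := valP e. Qed.

Lemma edge_sizes_subdiv : edge_sizes (subdiv E) =i edge_sizes E.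
Proof.
move=> k; apply/edge_sizesP/edge_sizesP => -[F].
  case/subdivP => [[F0 [F0E _ ->]] ->|[e [x [_ ->]]] ->].
    by exists F0; rewrite // card_imset //; apply: inl_inj.
  by exists (val e); rewrite ?two_edges_in // cards2 card_two_edges.
move=> FE ->; case: (boolP (#|F| == 2)) => F2; last first.
  exists ((@inl V (two_edges E)) @: F); first by apply/subdivP; left; exists F.
  by rewrite card_imset //; apply: inl_inj.
pose e : two_edges E := Sub F (introT andP (conj FE F2)).
have /card_gt0P[x xF] : (0 < #|F|)%N by rewrite (eqP F2).
exists [set inl x; inr e]; last by rewrite cards2 (eqP F2).
by apply/subdivP; right; exists e, x.
Qed.

Lemma hcontains_subdiv (T : finType) (G : {set {set T}}) (f : V -> T)
    (g : two_edges E -> T) :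
  injective f -> injective g -> (forall v e, g e != f v) ->
  (forall F, F \in E -> #|F| != 2 -> f @: F \in G) ->
  (forall (e : two_edges E) x, x \in val e -> [set f x; g e] \in G) ->
  hcontains (subdiv E) G.
Proof.
move=> f_inj g_inj g_neq_f fG gG; apply/hcontainsP.
exists (fun u => match u with inl v => f v | inr e => g e end).
  move=> [v1|e1] [v2|e2] => [/f_inj->||/eqP|/g_inj->] //.
    by move/esym/eqP; rewrite (negbTE (g_neq_f _ _)).
  by rewrite (negbTE (g_neq_f _ _)).
move=> F /subdivP[[F0 [F0E F0_not2 ->]]|[e [x [xe ->]]]].
  by rewrite -imset_comp; apply: fG.
by rewrite imsetU !imset_set1; apply: gG.
Qed.

End Subdivision.

Definition adj (T : finType) (G : {set {set T}}) : rel T :=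
  fun v w => (v != w) && ([set v; w] \in G).

Definition codegree_graph (T : finType) (G : {set {set T}}) (M : nat) :
    {set {set T}} :=
  [set F : {set T} | if #|F| == 2
     then (M <= #|\bigcap_(v in F) neighbors (adj G) v|)%N else F \in G].

Section CodegreeGraph.
Variables (T : finType) (G : {set {set T}}).

Lemma adj_sym : symmetric (adj G).
Proof. by move=> v w; rewrite /adj eq_sym setUC. Qed.

Lemma adj_codegree_graph M :
  adj (codegree_graph G M) =2 codegree_rel (adj G) M.
Proof.
move=> v w; rewrite /adj /codegree_rel inE cards2.
by case: (boolP (v == w)) => //= vw; rewrite big_setU1 ?inE // big_set1.
Qed.

Lemma degree_codegree_graph M :
  degree (adj (codegree_graph G M)) =1 degree (codegree_rel (adj G) M).
Proof.
by move=> v; apply: eq_card => w; rewrite !inE adj_codegree_graph.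
Qed.

Lemma degree_adj v :
  degree (adj G) v = #|[set F in G | (#|F| == 2) && (v \in F)]|.
Proof.
rewrite /degree -(card_in_imset (f := fun w => [set v; w])); last first.
  move=> w1 w2; rewrite !inE => /andP[vw1 _] /andP[vw2 _] eq_edge.
  have: w1 \in [set v; w2] by rewrite -eq_edge set22.
  by rewrite !inE eq_sym (negbTE vw1) => /eqP.
apply: eq_card => F; rewrite inE; apply/imsetP/and3P => [[w + ->]|[FG F2 vF]].
  by rewrite inE => /andP[vw ->]; rewrite cards2 vw set21.
have /cards1P[w FvE] : #|F :\ v| == 1 by rewrite (cardsD1 v) vF in F2.
have FE : F = [set v; w] by rewrite -(setD1K vF) FvE.
exists w; rewrite // inE /adj -FE FG andbT eq_sym.
by have: w \in F :\ v; [rewrite FvE set11 | rewrite !inE => /andP[]].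
Qed.

Lemma sum_degree_adj :
  (\sum_v degree (adj G) v = \sum_(F in G | #|F| == 2) 2)%N.
Proof.
transitivity (\sum_v \sum_(F in G | #|F| == 2) (v \in F : nat))%N.
  apply: eq_bigr => v _; rewrite degree_adj -sum1_card.
  rewrite big_mkcond [RHS]big_mkcond.
  by apply: eq_bigr => F _; rewrite inE; case: (F \in G); case: (_ == 2).
rewrite exchange_big; apply: eq_bigr => F /andP[_ /eqP <-].
by rewrite -sum1_card [RHS]big_mkcond.
Qed.

Lemma hcontains_subdiv_codegree_graph (V : finType) (E : {set {set V}}) :
  hcontains E (codegree_graph G #|subdiv_vertex E|) -> hcontains (subdiv E) G.
Proof.
case/hcontainsP => f f_inj fE.
pose common (e : two_edges E) := \bigcap_(v in f @: val e) neighbors (adj G) v.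
have common_large e : (#|V| + #|{: two_edges E}| <= #|common e|)%N.
  have := fE _ (two_edges_in e).
  by rewrite inE card_imset // card_two_edges /subdiv_vertex card_sum.
pose fresh e := common e :\: f @: [set: V].
have [e|g g_inj gC] := @injective_choice _ _ fresh.
  rewrite -(leq_add2l #|V|) (leq_trans (common_large e)) //.
  rewrite -(cardsID (f @: [set: V]) (common e)) leq_add2r.
  by rewrite (leq_trans (subset_leq_card (subsetIr _ _))) // card_imset ?cardsT.
apply: (hcontains_subdiv f_inj g_inj) => [v e|F FE F_not2|e x xe].
- have := gC e; rewrite inE => /andP[+ _].
  by apply: contraNneq => ->; rewrite imset_f.
- by have := fE F FE; rewrite inE card_imset // (negbTE F_not2).
- have := gC e; rewrite inE => /andP[_ /bigcapP/(_ (f x) (imset_f _ xe))].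
  by rewrite inE => /andP[].
Qed.

End CodegreeGraph.

Lemma admissible_codegree_graph (V : finType) (E : {set {set V}}) n
    (G : {set {set 'I_n}}) :
  2%N \in edge_sizes E -> admissible (subdiv E) G ->
  admissible E (codegree_graph G #|subdiv_vertex E|).
Proof.
move=> size2 /admissibleP[sizesG freeG]; apply/admissibleP; split.
  move=> F; rewrite inE; case: eqP => [-> //|_ FG].
  by rewrite -edge_sizes_subdiv sizesG.
by apply: contra freeG; apply: hcontains_subdiv_codegree_graph.
Qed.

Lemma hdens_split_degrees n (G : {set {set 'I_n}}) :
  hdens G = \sum_(F in G | #|F| != 2) ('C(n, #|F|)%:R)^-1 +
            (\sum_v (degree (adj G) v)%:R) / (n%:R * n.-1%:R).
Proof.
rewrite /hdens (bigID (fun F : {set 'I_n} => #|F| == 2)) /= addrC.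
congr (_ + _).
rewrite -natr_sum sum_degree_adj natr_sum mulr_suml.
apply: eq_bigr => F /andP[_ /eqP ->].
rewrite -natrM -[n.-1]ffactn1 -ffactnS -bin_ffact natrM invfM mulrCA.
by rewrite !factS fact0 muln1 mulfV ?mulr1 ?pnatr_eq0.
Qed.

Lemma hdens_codegree_graph_ge n (G : {set {set 'I_n}}) M D :
  0 < D ->
  hdens G <= hdens (codegree_graph G M) + codegree_loss M n D / n.-1%:R.
Proof.
move=> D_gt0; rewrite !hdens_split_degrees -addrA.
have same_non2 (F : {set 'I_n}) :
    (F \in codegree_graph G M) && (#|F| != 2) = (F \in G) && (#|F| != 2).
  by rewrite inE; case: eqP; rewrite ?andbF.
rewrite [X in _ <= X + _](eq_bigl _ _ same_non2).
rewrite lerD2l; set total := \sum_v _; set total' := \sum_v _.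
have total_le : total <= total' + n%:R * codegree_loss M n D.
  have := sum_degree_le_codegree_rel (@adj_sym _ G) M D_gt0; rewrite card_ord.
  by under [X in _ <= X + _]eq_bigr do rewrite -degree_codegree_graph.
apply: le_trans (ler_wpM2r _ total_le) _; first by rewrite invr_ge0 mulr_ge0.
rewrite mulrDl lerD2l invfM mulrACA ler_piMl ?divr_ge0 ?codegree_loss_ge0 //.
by have [->|?] := eqVneq (n%:R : Rdefinitions.R) 0; rewrite ?mul0r ?divff.
Qed.

Lemma hdens_all_edges n (s : seq nat) :
  uniq s -> {in s, forall k, (k <= n)%N} ->
  hdens [set F : {set 'I_n} | #|F| \in s] = (size s)%:R.
Proof.
move=> s_uniq s_le.
transitivity (\sum_(k <- s) \sum_(F : {set 'I_n} | k == #|F|)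
    ('C(n, k)%:R)^-1 : Rdefinitions.R).
  rewrite (exchange_big_dep predT) //= [LHS]big_mkcond; apply: eq_bigr => F _.
  rewrite -big_filter inE; case: ifPn => Fs.
    by rewrite filter_pred1_uniq // big_seq1.
  rewrite big_filter big_seq_cond big_pred0 // => k.
  by apply: contraNF Fs => /andP[+ /eqP <-].
rewrite -sum1_size natr_sum; apply: eq_big_seq => k /s_le k_le.
rewrite sumr_const -[_ *+ _]mulr_natr.
have -> : #|[pred F : {set 'I_n} | k == #|F|]| = 'C(n, k).
  rewrite -[in RHS](card_ord n) -card_draws.
  by apply: eq_card => F; rewrite !inE eq_sym.
by rewrite mulVf // pnatr_eq0 -lt0n bin_gt0.
Qed.

Lemma pi_n_ge0 (V : finType) (E : {set {set V}}) n : 0 <= pi_n E n.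
Proof. exact: bigmax_ge_id. Qed.

Lemma pi_n_ge (V : finType) (E : {set {set V}}) n :
  E != set0 -> (#|V| <= n)%N -> (size (edge_sizes E))%:R - 1 <= pi_n E n.
Proof.
case/set0Pn=> F0 F0E V_le; set k := #|F0|.
have k_size : k \in edge_sizes E by apply/edge_sizesP; exists F0.
pose s := rem k (edge_sizes E).
have s_uniq : uniq s by rewrite rem_uniq // undup_uniq.
have mem_s j : (j \in s) = (j != k) && (j \in edge_sizes E).
  by rewrite mem_rem_uniq ?undup_uniq // inE.
have s_le : {in s, forall j, (j <= n)%N}.
  move=> j; rewrite mem_s => /andP[_ /edge_sizesP[F _ ->]].
  exact: leq_trans (max_card _) V_le.
have -> : (size (edge_sizes E))%:R - 1 = (size s)%:R :> Rdefinitions.R.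
  by rewrite size_rem // -subn1 natrB //; case: (edge_sizes E) k_size.
rewrite -(hdens_all_edges s_uniq s_le); apply: le_bigmax_cond.
apply/admissibleP; split=> [F|]; first by rewrite inE mem_s => /andP[].
apply/negP => /hcontainsP[f f_inj /(_ _ F0E)].
by rewrite inE mem_s card_imset // eqxx.
Qed.

Lemma pi_n_subdiv_le (V : finType) (E : {set {set V}}) n D :
  2%N \in edge_sizes E -> 0 < D ->
  pi_n (subdiv E) n <=
  pi_n E n + codegree_loss #|subdiv_vertex E| n D / n.-1%:R.
Proof.
move=> size2 D_gt0; apply/bigmax_leP; split=> [|G admG].
  by rewrite addr_ge0 ?pi_n_ge0 // divr_ge0 ?codegree_loss_ge0.
apply: le_trans (hdens_codegree_graph_ge G #|subdiv_vertex E| D_gt0) _.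
by rewrite lerD2r; apply: le_bigmax_cond; apply: admissible_codegree_graph.
Qed.

Local Open Scope classical_set_scope.

Lemma cvg_inv_sqrtS (R : realType) :
  (fun n => (Num.sqrt n.+1%:R)^-1 : R) @ \oo --> (0 : R).
Proof.
have -> : (fun n : nat => (Num.sqrt n.+1%:R)^-1 : R) =
          (fun n => Num.sqrt (harmonic n)).
  by apply: funext => n; rewrite /harmonic sqrtrV.
rewrite -[X in _ --> X](@sqrtr0 R).
by apply: continuous_cvg; [exact: sqrt_continuous|exact: cvg_harmonic].
Qed.

(* With [D = sqrt n.-1] the relative loss is a polynomial in [1 / D] without
   constant term. *)
Lemma cvg_codegree_loss (R : realType) (M : nat) :
  (fun n => codegree_loss M n (Num.sqrt n.-1%:R) / n.-1%:R : R) @ \oo -->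
  (0 : R).
Proof.
pose t n : R := (Num.sqrt n.+1%:R)^-1.
have t_cvg : t @ \oo --> 0 by apply: cvg_inv_sqrtS.
pose loss n : R := t n * (t n + 1 + M%:R * (1 + t n * t n)).
have loss_cvg : loss @ \oo --> 0.
  rewrite -[X in _ --> X](mul0r (0 + 1 + M%:R * (1 + 0 * 0))).
  apply: cvgM => //; apply: cvgD; first by apply: cvgD => //; apply: cvg_cst.
  apply: cvgM; first exact: cvg_cst.
  by apply: cvgD; [apply: cvg_cst|apply: cvgM].
rewrite -(cvg_shiftn 2) [X in X @ _](_ : _ = loss) //.
apply: funext => n /=; rewrite addn2 /codegree_loss /loss /t -[n.+2%:R]natr1.
have := sqr_sqrtr (ler0n R n.+1); have: 0 < Num.sqrt n.+1%:R :> R.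
  by rewrite sqrtr_gt0 ltr0n.
by set D := Num.sqrt _ => D_gt0 <-; field; rewrite gt_eqF.
Qed.

Lemma degenerate_pi_n_le (V V' : finType) (E : {set {set V}})
    (E' : {set {set V'}}) (loss : nat -> Rdefinitions.R) :
  E' != set0 -> edge_sizes E' =i edge_sizes E ->
  loss @ \oo --> (0 : Rdefinitions.R) ->
  (\forall n \near \oo, pi_n E' n <= pi_n E n + loss n) ->
  degenerate E -> degenerate E'.
Proof.
move=> E'_neq0 same_sizes loss_cvg pi_le degE.
have size_eq : size (edge_sizes E') = size (edge_sizes E).
  by apply/perm_size/uniq_perm; rewrite ?undup_uniq.
rewrite /degenerate.
apply: (@squeeze_cvgr _ _ _ _ (fun=> (size (edge_sizes E'))%:R - 1)
  (fun n => pi_n E n + loss n)).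
- near=> n; apply/andP; split; last by near: n.
  by apply: pi_n_ge => //; near: n; apply: nbhs_infty_ge.
- exact: cvg_cst.
- by rewrite -[X in _ --> X]addr0 size_eq; apply: cvgD.
Unshelve. all: by end_near.
Qed.

Local Close Scope classical_set_scope.
Local Close Scope ring_scope.

Theorem mainTheorem13 (V : finType) (E : {set {set V}}) :
  (exists2 F, F \in E & #|F| = 2) ->
  degenerate E -> degenerate (subdiv E).
Proof.
move=> [F FE F2].
have size2 : 2 \in edge_sizes E by apply/edge_sizesP; exists F.
have subdiv_neq0 : subdiv E != set0.
  apply/set0Pn; move: size2; rewrite -edge_sizes_subdiv.
  by case/edge_sizesP=> F' F'E _; exists F'.
apply: degenerate_pi_n_le (cvg_codegree_loss #|subdiv_vertex E|) _ => //.
  exact: edge_sizes_subdiv.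
near=> n; apply: pi_n_subdiv_le => //.
rewrite sqrtr_gt0 ltr0n -subn1 subn_gt0.
by near: n; apply: nbhs_infty_gt.
Unshelve. all: by end_near.
Qed.
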